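(* Let $R$ be a finite commutative ring with unity having an odd number of elements, and suppose $R = R_1 \times \cdots \times R_m$ is a direct product of $m$ finite local rings, where $M_i$ denotes the unique maximal ideal of $R_i$. Then \[ m + \prod_{i=1}^m \left( \frac{|R_i| - |M_i|}{2} \right) = \omega(\mathcal{U}(R_1 \times \cdots \times R_m)) = \chi(\mathcal{U}(R_1 \times \cdots \times R_m)). \]
   Context: For a finite ring $R$ with unity and unit group $R^*$, the unitary addition Cayley graph $\mathcal{U}(R)$ is the simple graph with vertex set $R$ in which distinct vertices $x,y$ are adjacent if and only if $x+y \in R^*$. A local ring is a commutative ring with unity having a unique maximal ideal. $\omega(G)$ denotes the clique number and $\chi(G)$ the chromatic number of a graph $G$. *)

(* Defs.v *)
From HB Require Import structures.
From mathcomp Require Import all_boot all_algebra.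

Set Implicit Arguments.
Unset Strict Implicit.
Unset Printing Implicit Defensive.

Import GRing.Theory.
Local Open Scope ring_scope.

Record sgraph (T : finType) := SGraph {
  adj :> rel T;
  adj_sym : symmetric adj;
  adj_irrefl : irreflexive adj
}.

Definition is_clique (T : finType) (G : sgraph T) (A : {set T}) : bool :=
  [forall x in A, forall y in A, (x != y) ==> G x y].

Definition clique_number (T : finType) (G : sgraph T) : nat :=
  (\max_(A : {set T} | is_clique G A) #|A|)%N.

Definition colorable (T : finType) (G : sgraph T) (k : nat) : bool :=
  [exists f : {ffun T -> 'I_k}, forall x, forall y, G x y ==> (f x != f y)].

Lemma ex_colorable (T : finType) (G : sgraph T) : exists k, colorable G k.
Proof.
exists #|T|; apply/existsP; exists [ffun x => enum_rank x].
apply/'forall_forallP => x y; apply/implyP => Gxy; rewrite !ffunE.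
by apply: contraTneq Gxy => /enum_rank_inj ->; rewrite adj_irrefl.
Qed.

Definition chromatic_number (T : finType) (G : sgraph T) : nat :=
  ex_minn (ex_colorable G).

Section UnitaryAdditionCayley.
Variable R : finUnitRingType.

Definition uac_adj : rel R :=
  [rel x y | (x != y) && (x + y \is a GRing.unit)].

Lemma uac_adj_sym : symmetric uac_adj.
Proof. by move=> x y; rewrite /uac_adj /= eq_sym addrC. Qed.

Lemma uac_adj_irrefl : irreflexive uac_adj.
Proof. by move=> x; rewrite /uac_adj /= eqxx. Qed.

Definition unitary_addition_cayley : sgraph R :=
  SGraph uac_adj_sym uac_adj_irrefl.

End UnitaryAdditionCayley.

(* [idealr_closed] includes properness ([1 \notin I]).  In a finite ring every
   ideal is a [{set R}], so quantifying over [{set R}] misses none. *)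
Definition maximal_ideal (R : finComUnitRingType) (M : {set R}) : Prop :=
  idealr_closed M /\
  forall I : {set R}, idealr_closed I -> M \subset I -> I = M.

Definition local_ring (R : finComUnitRingType) : Prop :=
  exists! M : {set R}, maximal_ideal M.

(* The library has no ring structure on dependent finite products.  The index
   set is nonempty because a [finComUnitRingType] satisfies [1 != 0]. *)
Definition prod_ring (n : nat) (R : 'I_n.+1 -> finComUnitRingType) : Type :=
  {dffun forall i : 'I_n.+1, R i}.

Section ProdRing.
Variables (n : nat) (R : 'I_n.+1 -> finComUnitRingType).
Local Notation P := (prod_ring R).
Implicit Types x y z : P.

HB.instance Definition _ := Finite.on P.

Definition prod_zero : P := [ffun i => 0 : R i].
Definition prod_one : P := [ffun i => 1 : R i].
Definition prod_opp x : P := [ffun i => - x i : R i].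
Definition prod_add x y : P := [ffun i => x i + y i : R i].
Definition prod_mul x y : P := [ffun i => x i * y i : R i].
Definition prod_unit : {pred P} :=
  [pred x : P | [forall i, x i \is a GRing.unit]].
Definition prod_inv x : P :=
  if x \in prod_unit then [ffun i => (x i)^-1 : R i] else x.

Lemma prod_addA : associative prod_add.
Proof. by move=> x y z; apply/ffunP => i; rewrite !ffunE addrA. Qed.
Lemma prod_addC : commutative prod_add.
Proof. by move=> x y; apply/ffunP => i; rewrite !ffunE addrC. Qed.
Lemma prod_add0 : left_id prod_zero prod_add.
Proof. by move=> x; apply/ffunP => i; rewrite !ffunE add0r. Qed.
Lemma prod_addN : left_inverse prod_zero prod_opp prod_add.
Proof. by move=> x; apply/ffunP => i; rewrite !ffunE addNr. Qed.

HB.instance Definition _ :=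
  GRing.isZmodule.Build P prod_addA prod_addC prod_add0 prod_addN.

Lemma prod_mulA : associative prod_mul.
Proof. by move=> x y z; apply/ffunP => i; rewrite !ffunE mulrA. Qed.
Lemma prod_mulC : commutative prod_mul.
Proof. by move=> x y; apply/ffunP => i; rewrite !ffunE mulrC. Qed.
Lemma prod_mul1 : left_id prod_one prod_mul.
Proof. by move=> x; apply/ffunP => i; rewrite !ffunE mul1r. Qed.
Lemma prod_mulDl : left_distributive prod_mul prod_add.
Proof. by move=> x y z; apply/ffunP => i; rewrite !ffunE mulrDl. Qed.
Lemma prod_one_neq0 : prod_one != prod_zero.
Proof. by apply/eqP => /ffunP/(_ ord0)/eqP; rewrite !ffunE oner_eq0. Qed.

HB.instance Definition _ :=
  GRing.Zmodule_isComNzRing.Build P prod_mulA prod_mulC prod_mul1 prod_mulDl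
    prod_one_neq0.

Lemma prod_mulV : {in prod_unit, left_inverse (1 : P) prod_inv *%R}.
Proof.
move=> x Ux; apply/ffunP => i; rewrite /prod_inv Ux !ffunE mulVr //.
exact: (forallP Ux).
Qed.
Lemma prod_unitP x y : y * x = 1 -> prod_unit x.
Proof.
move=> /ffunP yx1; apply/forallP => i; apply/unitrPr; exists (y i).
by rewrite mulrC; have := yx1 i; rewrite !ffunE.
Qed.
Lemma prod_inv_out : {in [predC prod_unit], prod_inv =1 id}.
Proof. by move=> x /negbTE xnU; rewrite /prod_inv xnU. Qed.

HB.instance Definition _ :=
  GRing.ComNzRing_hasMulInverse.Build P prod_mulV prod_unitP prod_inv_out.

End ProdRing.

(* Main.v *)
(** Let [H_i] be a set of units of [R_i], closed under the equivalence modulo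
    [M_i], that contains exactly one of [u] and [- u] for each unit [u].  Sums
    of elements of [H_i] are units, since [2] is.  Fix [h_i] in [H_i] and let
    [e_i] be [h] with its [i]-th coordinate replaced by [0]; the product of the
    [H_i] together with the [e_i] is a clique.  The graph has a proper colouring
    whose colours are the vertices of that clique: a unit is coloured by
    changing the signs of its coordinates so that they lie in the [H_i], and
    a nonunit [x] by [e_i] for some [i] such that [x_i] lies in [M_i]. *)

Require Import Defs.
From mathcomp Require Import all_boot all_algebra.

Set Implicit Arguments.
Unset Strict Implicit.
Unset Printing Implicit Defensive.

Import GRing.Theory.
Local Open Scope ring_scope.

Section Graph.
Variables (T : finType) (G : sgraph T).

Lemma clique_colorable (A : {set T}) k :
  is_clique G A -> colorable G k -> (#|A| <= k)%N.
Proof.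
move=> /forall_inP cA /existsP[f /'forall_forallP fP].
rewrite -[k]card_ord; apply: (@leq_card_in _ _ f) => x y Ax Ay.
apply: contra_eq => xy.
by apply: (implyP (fP x y)); apply: (implyP (forall_inP (cA x Ax) y Ay)).
Qed.

(** Any clique injects into the colours of any proper colouring. So no clique is larger than the
    palette [A], and no palette is smaller than the clique [A]. *)
Lemma clique_coloring (A : {set T}) (f : T -> T) :
    is_clique G A -> (forall x, f x \in A) ->
    (forall x y, G x y -> f x != f y) ->
  clique_number G = #|A| /\ chromatic_number G = #|A|.
Proof.
move=> cA fA fG.
have colA : colorable G #|A|.
  apply/existsP; exists [ffun x => enum_rank_in (fA x) (f x)].
  apply/'forall_forallP => x y; apply/implyP => /fG; rewrite !ffunE.
  apply: contra_neq => /(congr1 enum_val).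
  by rewrite !enum_rankK_in.
split.
  apply/eqP; rewrite eqn_leq; apply/andP; split.
    by apply/bigmax_leqP => B cB; apply: clique_colorable.
  by rewrite /clique_number; apply: leq_bigmax_cond.
rewrite /chromatic_number; case: ex_minnP => k colk mink.
by apply/eqP; rewrite eqn_leq mink // clique_colorable.
Qed.

End Graph.

Section OddLocalRing.
Variable R : finComUnitRingType.

(** Translation by [1] permutes [R]; comparing the sum of all elements before and after shows that
    [#|R|] vanishes in [R]. Writing [#|R|] as [1 + 2k] then makes [- k] an inverse of [2]. *)
Lemma odd_card_unit2 : odd #|R| -> (1 + 1 : R) \is a GRing.unit.
Proof.
move=> oddR.
have cardR0 : #|R|%:R = 0 :> R.
  have : \sum_(x : R) x = \sum_(x : R) (x + 1).
    exact: (reindex_inj (addIr 1)).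
  by rewrite big_split sumr_const -[LHS]addr0 => /addrI.
apply/unitrPr; exists (- (#|R|./2)%:R).
move: cardR0; rewrite -[X in X%:R = _]odd_double_half oddR -muln2 natrD natrM.
by move=> /eqP; rewrite addr_eq0 => /eqP/esym; rewrite mulrN mulrC.
Qed.

(** A nonunit generates a proper ideal, which extends to a maximal one; by uniqueness that ideal is
    [M]. *)
Lemma local_ring_unit (M : {set R}) (x : R) :
  local_ring R -> maximal_ideal M -> (x \is a GRing.unit) = (x \notin M).
Proof.
move=> [M0 [_ uniqM]] maxM; have [[M_0 M_1 MP] _] := maxM.
apply/idP/idP => [Ux | ].
  apply: contra M_1 => Mx; rewrite -(mulVr Ux) -[_ * _]addr0.
  exact: MP.
apply: contraR => nUx.
(* A boolean form of [idealr_closed], as [maxset] requires. *)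
pose P (I : {set R}) := [&& 0 \in I, 1 \notin I &
  [forall a, forall u in I, forall v in I, a * u + v \in I]].
have PP (I : {set R}) : reflect (idealr_closed I) (P I).
  apply: (iffP and3P) => -[I0 I1 IP]; split=> //.
    move=> a u v Iu; apply/forall_inP: v.
    by apply/forall_inP: u Iu; apply/forallP: a.
  by apply/forallP=> a; apply/forall_inP=> u Iu; apply/forall_inP=> v; apply: IP.
have Px : P [set a * x | a : R].
  apply/PP; split.
  - by apply/imsetP; exists 0; rewrite ?mul0r.
  - apply: contra nUx => /imsetP[a _ /esym ax1].
    by apply/unitrPr; exists a; rewrite mulrC.
  - move=> a _ _ /imsetP[b _ ->] /imsetP[c _ ->].
    by apply/imsetP; exists (a * b + c); rewrite // mulrDl mulrA.
have [N /maxsetP[/PP idN maxN] /subsetP xN] := maxset_exists Px.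
have maximalN : maximal_ideal N by split=> // I /PP; apply: maxN.
rewrite -(uniqM _ maxM) (uniqM _ maximalN).
by apply: xN; apply/imsetP; exists 1; rewrite ?mul1r.
Qed.

Lemma half_unit_exists (M : {set R}) :
    odd #|R| -> local_ring R -> maximal_ideal M ->
  exists H : {set R}, [/\ {in H &, forall x y, x + y \is a GRing.unit},
    forall x, x \is a GRing.unit = (x \in H) || (- x \in H)
    & #|R| = (#|M| + #|H|.*2)%N].
Proof.
move=> /odd_card_unit2 U2 locR maxM.
have unitE x := local_ring_unit x locR maxM.
have [idM _] := maxM; have [M0 MB] := idealr_closedB idM.
have MN x : (- x \in M) = (x \in M).
  by rewrite -[RHS]negbK -[LHS]negbK -!unitE unitrN.
have MD u v : u \in M -> v \in M -> u + v \in M.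
  by move=> Mu; rewrite -MN => /(MB _ _ Mu); rewrite opprK.
(* [c x] numbers the coset of [x] modulo [M]. *)
pose c x : 'I_#|{set R}| := enum_rank [set y | x - y \in M].
have cE x y : (c x == c y) = (x - y \in M).
  rewrite (inj_eq enum_rank_inj); apply/eqP/idP => [/setP/(_ y) | Mxy].
    by rewrite !inE subrr M0.
  apply/setP => z; rewrite !inE -[x - z](subrKA y) addrC.
  by apply/idP/idP => [/MB/(_ Mxy) | /MD/(_ Mxy)//]; rewrite addrK.
(* Through [c], cosets of [M] are totally ordered. *)
pose H := [set x | x \notin M & (c x < c (- x))%N].
have HU x : x \is a GRing.unit = (x \in H) || (- x \in H).
  rewrite unitE !inE opprK MN -andb_orr -neq_ltn.
  (* The cosets of [x] and [- x] agree exactly when [2x] lies in [M], that is, when [x] does, as [2]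
     is a unit. *)
  have -> : (c x != c (- x) :> nat) = (x \notin M).
    have -> : (c x == c (- x) :> nat) = (c x == c (- x)) by [].
    rewrite cE opprK -[x + x]mulr1 -mulr2n mulrnAl -mulrnAr.
    by rewrite -unitE unitrM unitE mulr2n U2 andbT.
  by rewrite andbb.
have HD : {in H &, forall x y, x + y \is a GRing.unit}.
  move=> x y; rewrite !inE unitE => /andP[_ ltx] /andP[_ lty].
  (* If [x + y] were in [M], then [c x < c (- x) = c y < c (- y) = c x]. *)
  apply/negP => Mxy.
  have /eqP cxy : c x == c (- y) by rewrite cE opprK.
  have /eqP cyx : c y == c (- x) by rewrite cE opprK addrC.
  by move: ltx; rewrite cxy -cyx ltnNge ltnW.
exists H; split=> //.
have -> : #|R| = (#|M| + #|~: M|)%N by rewrite cardsC.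
congr (_ + _)%N.
have -> : ~: M = H :|: -%R @^-1: H.
  by apply/setP => x; rewrite in_setC -unitE HU in_setU; congr (_ || _); rewrite [RHS]inE.
rewrite cardsU card_preimset; last exact: oppr_inj.
(* An [x] with both [x] and [- x] in [H] would make their sum [0] a unit. *)
rewrite (_ : H :&: _ = set0) ?cards0 ?subn0 ?addnn //.
apply/setP => x; rewrite in_set0 in_setI; apply/negP => /andP[Hx].
rewrite inE => HNx; by have := HD _ _ Hx HNx; rewrite subrr unitr0.
Qed.

End OddLocalRing.

Section Product.
Variables (n : nat) (R : 'I_n.+1 -> finComUnitRingType).
Variable H : forall i, {set R i}.
Hypothesis HD : forall i, {in H i &, forall x y, x + y \is a GRing.unit}.
Hypothesis HU : forall i (x : R i),
  x \is a GRing.unit = (x \in H i) || (- x \in H i).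
Hypothesis nonunitD : forall i (x y : R i),
  x \isn't a GRing.unit -> y \isn't a GRing.unit ->
  x + y \isn't a GRing.unit.

Local Notation P := (prod_ring R).
Local Notation G := (unitary_addition_cayley P).

Lemma prod_unitrE (x : P) :
  (x \is a GRing.unit) = [forall i, x i \is a GRing.unit].
Proof. by []. Qed.

Lemma half_unit i (x : R i) : x \in H i -> x \is a GRing.unit.
Proof. by rewrite HU => ->. Qed.

Let half_nonempty i : {x : R i | x \in H i}.
Proof.
apply/sigW; have := unitr1 (R i); rewrite HU.
by case/orP; [exists 1 | exists (- 1)].
Qed.
Let h i : R i := sval (half_nonempty i).
Let hH i : h i \in H i := svalP (half_nonempty i).

Let e i : P := [ffun j => if j == i then 0 else h j].
Let norm (x : P) : P := [ffun i => if x i \in H i then x i else - x i].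
Let color (x : P) : P :=
  if [pick i | x i \isn't a GRing.unit] is Some i then e i else norm x.
Let half_clique : {set P} := setXn H :|: [set e i | i : 'I_n.+1].

Let eE i : e i i = 0.
Proof. by rewrite ffunE eqxx. Qed.

Let eH i j : j != i -> e i j \in H j.
Proof. by rewrite ffunE => /negbTE ->. Qed.

(** The nonunit coordinate reveals [i]: this gives injectivity of [e] and separates each [e i] from
    the colours of units. *)
Let e_nonunit i j : (e i j \is a GRing.unit) = (j != i).
Proof.
by have [->|/eH/half_unit//] := eqVneq; rewrite eE unitr0.
Qed.

Let e_inj : injective e.
Proof.
move=> i j eij; have := e_nonunit i i.
by rewrite eij e_nonunit eqxx => /negbFE/eqP.
Qed.

(** At coordinate [i], every member other than [e i] lies in [H i]. Two distinct members are not
    both [e i], so their coordinates add up to an element of [H i] or to a sum of two such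
    elements. *)
Lemma half_clique_clique : is_clique G half_clique.
Proof.
apply/forall_inP => x Cx; apply/forall_inP => y Cy; apply/implyP => xy.
apply/andP; split=> //; rewrite prod_unitrE; apply/forallP => i; rewrite ffunE.
have coord z : z \in half_clique -> z = e i \/ z i \in H i.
  case/setUP => [/setXnP Hz | /imsetP[j _ ->]]; first by right; apply: Hz.
  by have [->|/eH] := eqVneq i j; [left | right].
have [xe|Hx] := coord x Cx; have [ye|Hy] := coord y Cy.
- by rewrite xe ye eqxx in xy.
- by rewrite xe eE add0r half_unit.
- by rewrite ye eE addr0 half_unit.
- exact: HD.
Qed.

Let color_in x : color x \in half_clique.
Proof.
rewrite /color; case: pickP => [i _ | Ux]; apply/setUP.
  by right; apply/imsetP; exists i.
left; apply/setXnP => i; rewrite ffunE; case: ifP => // nHx.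
by have /negbFE := Ux i; rewrite HU nHx.
Qed.

Let norm_unit (x : P) :
  (forall i, x i \is a GRing.unit) -> forall i, norm x i \is a GRing.unit.
Proof. by move=> Ux i; rewrite ffunE; case: ifP; rewrite ?unitrN Ux. Qed.

Let color_proper x y : G x y -> color x != color y.
Proof.
case/andP => xy; rewrite prod_unitrE => /forallP Uxy; apply/eqP; move: xy.
rewrite /color; case: pickP => [i nUx | Ux]; case: pickP => [j nUy | Uy] xy.
(* Nonunits with the same colour share a nonunit coordinate, where their sum is again a nonunit. *)
- move/e_inj => ij; rewrite -ij in nUy.
  by have := Uxy i; rewrite ffunE (negbTE (nonunitD nUx nUy)).
- move/(congr1 (fun z : P => z i \is a GRing.unit)).
  by rewrite e_nonunit eqxx norm_unit // => k; apply: negbFE.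
- move/(congr1 (fun z : P => z j \is a GRing.unit)).
  by rewrite e_nonunit eqxx norm_unit // => k; apply: negbFE.
(* Equal norms force [x i] to be [y i] or [- y i]; adjacency excludes the latter, as [0] is not a
   unit, hence [x = y]. *)
move=> /ffunP nxy; case/eqP: xy; apply/ffunP => i.
have : x i != - y i.
  have := Uxy i; rewrite ffunE -addr_eq0.
  by apply: contraTneq => ->; rewrite unitr0.
have := nxy i; rewrite !ffunE; case: ifP; case: ifP => // _ _.
- by move=> ->; rewrite eqxx.
- by move=> <-; rewrite opprK eqxx.
- by move/oppr_inj.
Qed.

Let card_half_clique : #|half_clique| = (n.+1 + \prod_i #|H i|)%N.
Proof.
rewrite cardsU card_imset // cardsXn card_ord addnC.
(* The two pieces are disjoint: [e i] has a zero coordinate, while the product of the [H i] contains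
   only units. *)
rewrite (_ : _ :&: _ = set0) ?cards0 ?subn0 //.
apply/setP => x; rewrite in_set0 in_setI; apply/negP.
move=> /andP[/setXnP Hx /imsetP[i _ xe]].
by have := half_unit (Hx i); rewrite xe eE unitr0.
Qed.

Lemma prod_clique_chromatic :
  clique_number G = (n.+1 + \prod_i #|H i|)%N /\
  chromatic_number G = (n.+1 + \prod_i #|H i|)%N.
Proof.
rewrite -card_half_clique.
exact: clique_coloring half_clique_clique color_in color_proper.
Qed.

End Product.

Lemma odd_card_factor n (R : 'I_n.+1 -> finComUnitRingType) i :
  odd #|{: prod_ring R}| -> odd #|R i|.
Proof.
have -> : #|{: prod_ring R}| = (\prod_j #|R j|)%N.
  transitivity #|setXn (fun j => [set: R j])|.
    by apply: eq_card => x; symmetry; apply/setXnP => j; rewrite inE.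
  by rewrite cardsXn; apply: eq_bigr => j _; rewrite cardsT.
by rewrite (bigD1 i) //= oddM => /andP[].
Qed.

Theorem theorem1 (n : nat) (R : 'I_n.+1 -> finComUnitRingType)
    (M : forall i : 'I_n.+1, {set R i})
    (R_odd : odd #|{: prod_ring R}|)
    (R_local : forall i : 'I_n.+1, local_ring (R i))
    (M_max : forall i : 'I_n.+1, maximal_ideal (M i)) :
  (n.+1)%:R + \prod_(i < n.+1) ((#|R i|%:R - #|M i|%:R) / 2)
    = (clique_number (unitary_addition_cayley (prod_ring R)))%:R :> rat
  /\ clique_number (unitary_addition_cayley (prod_ring R))
    = chromatic_number (unitary_addition_cayley (prod_ring R)).
Proof.
have [H HP] := fin_all_exists (fun i =>
  half_unit_exists (odd_card_factor i R_odd) (R_local i) (M_max i)).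
have HD i : {in H i &, forall x y, x + y \is a GRing.unit} by case: (HP i).
have HU i (x : R i) : x \is a GRing.unit = (x \in H i) || (- x \in H i).
  by case: (HP i).
have HC i : #|R i| = (#|M i| + #|H i|.*2)%N by case: (HP i).
have nonunitD i (x y : R i) : x \isn't a GRing.unit ->
    y \isn't a GRing.unit -> x + y \isn't a GRing.unit.
  rewrite !(local_ring_unit _ (R_local i) (M_max i)) !negbK => Mx My.
  by have [[_ _ /(_ 1 x y Mx My)]] := M_max i; rewrite mul1r.
have [-> ->] := prod_clique_chromatic HD HU nonunitD.
split=> //; rewrite natrD natr_prod; congr (_ + _).
apply: eq_bigr => i _.
(* Since [#|R i| - #|M i|] is twice [#|H i|], the halved factor is exactly [#|H i|]. *)
by rewrite HC -muln2 natrD natrM addrAC subrr add0r mulfK.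
Qed.
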